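(* Let $n$ be an even integer, and let $R=(r_1,r_2,\ldots,r_{n/2},r_{n/2},\ldots,r_2,r_1)$ be a vector of nonnegative integers such that $(r_1,r_2,\ldots,r_{n/2})$ is nondecreasing. Then there exists a combinatorially skew-Hankel tournament with score vector $R$ if and only if $$\sum_{i=1}^k r_i\ge k(k-1)\quad \left(k=1,2,\ldots,\frac{n}{2}\right),\ \mbox{ with equality for } k=\frac{n}{2}.$$
   Context: A combinatorially skew-Hankel tournament of order $n$ is an $n\times n$ $(0,1)$-matrix $T=[t_{ij}]$ such that $t_{ii}=t_{i,n+1-i}=0$ for all $i$, and, for all $i$ and all $j\ne i,n+1-i$, $t_{ji}=1-t_{ij}$ and $t_{n+1-j,n+1-i}=1-t_{ij}$. (Hence $t_{ij}=t_{n+1-i,n+1-j}$ for all $i,j$.) Its score vector is the vector of its row sums. *)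

(* Defs.v *)
From mathcomp Require Import all_boot all_order all_algebra.

Set Implicit Arguments.
Unset Strict Implicit.
Unset Printing Implicit Defensive.

(* Indices are 0-based, so the involution i |-> n + 1 - i is [rev_ord]. *)

(* Subtraction on [nat] is truncated; it is exact here because every entry is
   0 or 1. *)
Definition comb_skew_hankel_tournament (n : nat) (T : 'M[nat]_n) : Prop :=
  [/\ forall i j : 'I_n, T i j = 0 \/ T i j = 1,
      forall i : 'I_n, T i i = 0 /\ T i (rev_ord i) = 0 &
      forall i j : 'I_n, j <> i -> j <> rev_ord i ->
        T j i = 1 - T i j /\ T (rev_ord j) (rev_ord i) = 1 - T i j].

Definition score_vector (n : nat) (T : 'M[nat]_n) : n.-tuple nat :=
  [tuple \sum_(j < n) T i j | i < n].

(* Main.v *)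
Require Import Defs.
From mathcomp Require Import all_boot all_order all_algebra.
From mathcomp Require Import zify.

(** Put m = n/2 and call the indices i and n + 1 - i of a skew-Hankel
    tournament one player. For two players a <> b with representatives i and j,
    all eight entries between them are determined by the two bits t_ij and
    t_(i, n+1-j): central symmetry repeats them, and the two complement rules
    turn them into 1 - t_ij and 1 - t_(i, n+1-j) in the rows of b. Row i thus
    receives x_ab = t_ij + t_(i, n+1-j) from player b, and x_ab + x_ba = 2. The
    rows of the tournament therefore record a competition in which every two of
    the m players meet exactly twice, and conversely every such competition
    arises ([match_results_of_tournament], [tournament_of_match_results]).

    The question becomes Landau's theorem for c = 2 games per pair, proved here
    for any c ([landau]). A set A of players plays c * 'C(#|A|, 2) games
    internally, so its total score is at least that ([sum_wins_ge]). For
    sufficiency, start from an arbitrary competition. If some u has won too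
    often, let A be the set of players that u reaches along arcs i -> j with
    x_ij > 0. Nobody in A ever beats anyone outside A, so the total of A is
    exactly the number of internal games; the condition on A then forces some v
    in A to have won too rarely. Turning one game around on every arc of a path
    from u to v moves one win from u to v ([reverse_path]), so the total excess
    drops, and this can be repeated until the scores are the prescribed ones.

    Landau's condition concerns all sets A, but for nondecreasing scores the
    initial segments have the smallest totals among the sets of their size
    ([min_sum_ord]), and 2 * 'C(k, 2) = k * (k - 1). *)

Set Implicit Arguments.
Unset Strict Implicit.
Unset Printing Implicit Defensive.

(** * Landau's theorem with c games for every pair of players *)

Section Landau.

Variables (V : finType) (c : nat).
Implicit Types (x : V -> V -> nat) (r : V -> nat) (A : {set V}).

(** [x i j] is the number of games that [i] wins against [j]. *)
Definition match_results x :=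
  (forall i, x i i = 0) /\ (forall i j, i != j -> x i j + x j i = c).

Definition wins x i := \sum_j x i j.

(** Each of the 'C(#|A|, 2) pairs inside [A] shares out c wins. *)
Lemma sum_inner_wins x A : match_results x ->
  \sum_(i in A) \sum_(j in A) x i j = c * 'C(#|A|, 2).
Proof.
case=> x0 xC; set S := LHS.
(* Adding the double sum to its transpose pairs [x i j] with [x j i]. *)
have S2 : S + S = #|A| * #|A|.-1 * c.
  rewrite {2}/S exchange_big -big_split /=.
  rewrite (eq_bigr (fun=> #|A|.-1 * c)) => [|i iA].
    by rewrite sum_nat_const mulnA.
  rewrite -big_split (bigD1 i) //= !x0 add0n.
  rewrite (eq_bigr (fun=> c)) => [|j /andP[_ jNi]]; last by rewrite xC 1?eq_sym.
  rewrite sum_nat_const (cardD1 i A) iA /=; congr (_ * _).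
  by apply: eq_card => j; rewrite !inE andbC.
by have := mul_bin_diag #|A| 1; rewrite bin1; nia.
Qed.

Lemma sum_wins_ge x A : match_results x ->
  c * 'C(#|A|, 2) <= \sum_(i in A) wins x i.
Proof.
move=> xP; rewrite -(sum_inner_wins A xP); apply: leq_sum => i _.
by rewrite /wins [leqRHS](bigID (mem A)) /= leq_addr.
Qed.

Lemma sum_wins x : match_results x -> \sum_i wins x i = c * 'C(#|V|, 2).
Proof.
move=> xP; rewrite -cardsT -(sum_inner_wins [set: V] xP).
by apply: eq_big => [i | i _]; [|apply: eq_bigl => j]; rewrite inE.
Qed.

(** Turning around one game on each arc of a path costs an inner vertex one win
    and gives it one back; only the endpoints [u] and [last u p] change. The path
    has no repeated vertex, so that handling the arcs one after the other never
    destroys an arc still to be used. *)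
Lemma reverse_path x u p :
  match_results x -> uniq (u :: p) -> path (fun i j => 0 < x i j) u p ->
  exists2 y, match_results y &
    forall i, wins y i + (i == u) = wins x i + (i == last u p).
Proof.
elim: p u x => [|w p IHp] u x xP; first by exists x.
rewrite cons_uniq => /andP[uNwp wp_uniq] /= /andP[xuw_gt0 wp_path].
have uNw : u != w by apply: contraNneq uNwp => ->; apply: mem_head.
pose arc (a b i j : V) : nat := (i == a) && (j == b).
have arcC a b i j : arc a b j i = arc b a i j by rewrite /arc andbC.
have arc_sum a b i : \sum_j arc a b i j = (i == a).
  rewrite (bigD1 b) //= /arc eqxx andbT big1 ?addn0 // => j /negbTE->.
  by rewrite andbF.
(* One win of [u] over [w] becomes a win of [w] over [u]; as there is such a
   win, the truncated subtraction is exact. *)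
pose y i j := x i j + arc w u i j - arc u w i j.
have yE i j : y i j + arc u w i j = x i j + arc w u i j.
  rewrite subnK // /arc.
  case: (i =P u) => [->|_] //; case: (j =P w) => [->|_] //.
  exact: leq_trans xuw_gt0 (leq_addr _ _).
have yP : match_results y.
  case: xP => x0 xC; split=> [i | i j iNj].
    by rewrite /y x0 arcC subnn.
  by have := yE i j; have := yE j i; have := xC i j iNj; rewrite !(arcC _ _ i j); lia.
have y_wins i : wins y i + (i == u) = wins x i + (i == w).
  rewrite -(arc_sum u w) -(arc_sum w u) -!big_split.
  by apply: eq_bigr => j _; apply: yE.
have y_path : path (fun i j => 0 < y i j) w p.
  have away_u : {in predC1 u &, forall i j, y i j = x i j}.
    by move=> i j /negbTE iu /negbTE ju; rewrite /y /arc iu ju andbF addn0 subn0.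
  rewrite (@eq_in_path _ (predC1 u) _ (fun i j => 0 < x i j)) //.
    by move=> i j iu ju; rewrite /= away_u.
  by apply/allP => i; apply: contraTneq => ->.
have [z zP z_wins] := IHp w y yP wp_uniq y_path.
by exists z => // i; apply: (@addIn (i == w)); rewrite addnAC z_wins addnAC y_wins addnAC.
Qed.

(** Necessity counts the games inside [A]. Sufficiency is by induction on the
    total excess of the scores over [r], a path reversal lowering it by one. *)
Theorem landau r :
  (exists2 x, match_results x & wins x =1 r) <->
  (forall A, c * 'C(#|A|, 2) <= \sum_(i in A) r i) /\
  \sum_i r i = c * 'C(#|V|, 2).
Proof.
split=> [[x xP xr] | [r_ge r_sum]].
  split=> [A|]; first by rewrite -(eq_bigr _ (fun i _ => xr i)) sum_wins_ge.
  by rewrite -(eq_bigr _ (fun i _ => xr i)) sum_wins.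
suff fix_excess d x : match_results x -> \sum_i (wins x i - r i) <= d ->
    exists2 y, match_results y & wins y =1 r.
  pose x0 (i j : V) := if enum_rank i < enum_rank j then c else 0.
  apply: (fix_excess (\sum_i (wins x0 i - r i)) x0) => //.
  split=> [i | i j iNj]; rewrite /x0 ?ltnn //.
  have : enum_rank i != enum_rank j by rewrite (inj_eq enum_rank_inj).
  by rewrite -val_eqE /=; case: ltngtP; rewrite ?addn0.
(* The totals of [wins y] and [r] agree, so a pointwise bound is an equality. *)
have eq_of_le y : match_results y -> (forall i, wins y i <= r i) -> wins y =1 r.
  move=> yP le_r i; apply/eqP; move: i; apply/forallP.
  have /leqif_sum : forall i, true -> wins y i <= r i ?= iff (wins y i == r i).
    by move=> i _; split.
  by case=> _; rewrite sum_wins // r_sum eqxx => <-.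
elim: d x => [|d IHd] x xP excess.
  exists x => //; apply: eq_of_le => // i.
  by move: excess; rewrite (bigD1 i) //=; lia.
have [/forallP le_r | ] := boolP [forall i, wins x i <= r i].
  by exists x => //; apply: eq_of_le.
rewrite negb_forall => /existsP[u]; rewrite -ltnNge => u_excess.
(* No one in [A] ever wins against a player outside [A]; this is why all the
   wins of [A] are internal, and why [A] contains a player short of wins. *)
pose A := [set w | connect (fun i j => 0 < x i j) u w].
have uA : u \in A by rewrite inE connect0.
have closedA i : i \in A -> \sum_(j in A) x i j = wins x i.
  move=> iA; rewrite /wins [RHS](bigID (mem A)) /= [X in _ + X]big1 ?addn0 //.
  move=> j jNA; apply/eqP; rewrite -leqn0 leqNgt; apply: contra jNA => xij.
  by move: iA; rewrite !inE => /connect_trans; apply; apply: connect1.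
have [v vA v_lt] : exists2 v, v \in A & wins x v < r v.
  apply/exists_inP/contraT => /exists_inPn A_ge.
  have := r_ge A; rewrite -(sum_inner_wins A xP) (eq_bigr _ closedA) leqNgt.
  move=> /negP[]; rewrite (bigD1 u) //= [ltnRHS](bigD1 u) //= -addSn.
  by rewrite leq_add // leq_sum // => i /andP[/A_ge]; rewrite -leqNgt.
have [y yP y_wins] : exists2 y, match_results y &
    forall i, wins y i + (i == u) = wins x i + (i == v).
  move: vA; rewrite inE => /connectP[p /shortenP[q q_path q_uniq _] ->].
  exact: reverse_path.
apply: (IHd y yP); rewrite -ltnS; apply: leq_trans excess.
have uNv : u != v by apply: contraTneq u_excess => ->; lia.
rewrite (bigD1 u) //= [ltnRHS](bigD1 u) //= -addSn leq_add //.
  by have := y_wins u; rewrite eqxx (negbTE uNv); lia.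
apply: leq_sum => i /negbTE iu; have := y_wins i; rewrite iu.
by case: (i =P v) => [->|_]; lia.
Qed.

End Landau.

(** * Initial segments have the smallest total *)

Lemma card_ord_lt m k : k <= m -> #|[set i : 'I_m | i < k]| = k.
Proof.
move=> km; rewrite -sum1dep_card -(big_ord_widen m (fun=> 1) km).
by rewrite sum1_card card_ord.
Qed.

(** Cancel the common part of [A] and the initial segment [I] of the same size:
    the remaining parts have the same size too, and every index in [I :\: A] is
    below every index in [A :\: I]. *)
Lemma min_sum_ord m (f : 'I_m -> nat) (A : {set 'I_m}) :
  {homo f : i j / i <= j} -> \sum_(i < m | i < #|A|) f i <= \sum_(i in A) f i.
Proof.
move=> f_mono; pose I := [set i : 'I_m | i < #|A|].
have cardI : #|I| = #|A|.
  by apply: card_ord_lt; rewrite -[leqRHS]card_ord max_card.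
have -> : \sum_(i < m | i < #|A|) f i = \sum_(i in I) f i.
  by apply: eq_bigl => i; rewrite inE.
rewrite (big_setID A) [leqRHS](big_setID I) /=.
rewrite [A :&: I]setIC leq_add2l.
pose t := \max_(i in I :\: A) f i.
apply: (@leq_trans (\sum_(i in I :\: A) t)).
  by apply: leq_sum => i iIA; rewrite /t (bigD1 i) //= leq_maxl.
have -> : \sum_(i in I :\: A) t = \sum_(i in A :\: I) t.
  by rewrite !sum_nat_const !cardsD cardI setIC.
apply: leq_sum => i; rewrite !inE -leqNgt => /andP[iNI _].
by apply/bigmax_leqP => j; rewrite !inE => /andP[_ jI]; apply: f_mono; lia.
Qed.

(** * Skew-Hankel tournaments as competitions with two games per pair *)

(** The bits of the two entries with sum p are obtained by rounding p / 2 up for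
    one of them and down for the other. The direction of rounding is the boolean
    [d]; the opponent, with score q, must round in the opposite direction for
    the entries to be complementary. *)
Lemma round_half_compl p q (d : bool) :
  p + q = 2 -> (2 <= q + ~~ d) = 1 - (2 <= p + d) :> nat.
Proof. by case: p q d => [|[|[|p]]] [|[|[|q]]] []. Qed.

Lemma round_half_sum p (d : bool) :
  p <= 2 -> (2 <= p + d) + (2 <= p + ~~ d) = p.
Proof. by case: p d => [|[|[|p]]] []. Qed.

Lemma ltn_ord_neq m (a b : 'I_m) : a != b -> (b < a) = ~~ (a < b).
Proof. by rewrite -val_eqE /=; case: ltngtP. Qed.

Section Fold.

Variables (n m : nat).
Hypothesis nE : n = m.*2.

Lemma fold_subproof (i : 'I_n) : minn i (rev_ord i) < m.
Proof. by have := ltn_ord i; rewrite /=; lia. Qed.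

(** The player to which the index [i] belongs: [i] and [rev_ord i] are identified,
    and their minimum, which is below [m], is the representative. *)
Definition fold_ord i := Ordinal (fold_subproof i).

Lemma unfold_subproof : m <= n. Proof. by lia. Qed.

Definition unfold_ord (a : 'I_m) : 'I_n := widen_ord unfold_subproof a.

Lemma fold_rev i : fold_ord (rev_ord i) = fold_ord i.
Proof. by apply: val_inj; rewrite /=; have := ltn_ord i; lia. Qed.

Lemma fold_unfold a : fold_ord (unfold_ord a) = a.
Proof. by apply: val_inj => /=; have := ltn_ord a; lia. Qed.

Lemma fold_eq i j : fold_ord i = fold_ord j -> i = j \/ i = rev_ord j.
Proof.
move/(congr1 val) => /= eq_ij; have := (ltn_ord i, ltn_ord j) => -[].
case: (ltngtP i j) => [ij|ij|/val_inj]; last by left.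
- by move=> *; right; apply: val_inj => /=; lia.
- by move=> *; right; apply: val_inj => /=; lia.
Qed.

Lemma sum_fold (F : 'I_n -> nat) :
  \sum_j F j = \sum_a (F (unfold_ord a) + F (rev_ord (unfold_ord a))).
Proof.
rewrite (partition_big fold_ord xpredT) //=; apply: eq_bigr => a _.
have rev_neq : rev_ord (unfold_ord a) != unfold_ord a.
  by rewrite -val_eqE /=; have := ltn_ord a; lia.
rewrite (bigD1 (unfold_ord a)) ?fold_unfold //=.
rewrite (bigD1 (rev_ord (unfold_ord a))) ?fold_rev ?fold_unfold ?eqxx //=.
rewrite big1 ?addn0 // => j /andP[/andP[/eqP ja jN] jNr].
have [jE|jE] : j = unfold_ord a \/ j = rev_ord (unfold_ord a).
- by apply: fold_eq; rewrite fold_unfold.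
- by rewrite jE eqxx in jN.
- by rewrite jE eqxx in jNr.
Qed.

(** The complement rule applied to [(a, b)] and to [(a, rev b)] shows that each
    of the two entries is complementary to one of the entries in the row of
    [b]. *)
Lemma match_results_of_tournament (T : 'M[nat]_n) :
  comb_skew_hankel_tournament T ->
  exists2 x : 'I_m -> 'I_m -> nat, match_results 2 x &
    forall a, wins x a = \sum_j T (unfold_ord a) j.
Proof.
case=> T01 T0 TC; exists (fun a b =>
  T (unfold_ord a) (unfold_ord b) + T (unfold_ord a) (rev_ord (unfold_ord b))).
  split=> [a | a b aNb]; first by have [-> ->] := T0 (unfold_ord a).
  have ne1 : unfold_ord b <> unfold_ord a.
    by move/(congr1 fold_ord); rewrite !fold_unfold => ba; rewrite ba eqxx in aNb.
  have ne2 : unfold_ord b <> rev_ord (unfold_ord a).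
    move/(congr1 fold_ord); rewrite fold_rev !fold_unfold => ba.
    by rewrite ba eqxx in aNb.
  have [-> _] := TC _ _ ne1 ne2.
  have [||_] := TC (unfold_ord a) (rev_ord (unfold_ord b)).
  - by move=> e; apply: ne2; rewrite -e rev_ordK.
  - by move/rev_ord_inj.
  rewrite rev_ordK => ->.
  have := T01 (unfold_ord a) (unfold_ord b).
  by have := T01 (unfold_ord a) (rev_ord (unfold_ord b)); lia.
by move=> a; rewrite sum_fold.
Qed.

(** Two wins give two entries 1, no win gives two entries 0. When both players
    win once, row [i] takes its 1 in the column on the same side of the middle
    if the player of [i] is the smaller one, and on the opposite side otherwise;
    comparing sides keeps the matrix centrally symmetric. *)
Lemma tournament_of_match_results (x : 'I_m -> 'I_m -> nat) :
  match_results 2 x ->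
  exists2 T : 'M[nat]_n, comb_skew_hankel_tournament T &
    forall i, \sum_j T i j = wins x (fold_ord i).
Proof.
case=> x0 xC.
pose tie (i j : 'I_n) := if (i < m) == (j < m) then fold_ord i < fold_ord j
                         else fold_ord j < fold_ord i.
pose t i j := 2 <= x (fold_ord i) (fold_ord j) + tie i j.
have sideC (i : 'I_n) : (rev_ord i < m) = ~~ (i < m).
  by rewrite /=; have := ltn_ord i; lia.
have t_fold i j : fold_ord i = fold_ord j -> t i j = false.
  by rewrite /t => ->; rewrite x0; case: (tie i j).
exists (\matrix_(i, j) (t i j : nat))%R => [|i].
  split=> [i j | i | i j ji jri]; rewrite ?mxE.
  - by case: (t i j); [right | left].
  - by rewrite !t_fold // fold_rev.
  have iNj : fold_ord i != fold_ord j.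
    by apply/eqP => e; have [] := fold_eq (esym e).
  have flip : (fold_ord j < fold_ord i) = ~~ (fold_ord i < fold_ord j).
    exact: ltn_ord_neq.
  rewrite /t /tie !fold_rev !sideC flip.
  have rule := round_half_compl _ (xC _ _ iNj).
  have := rule (fold_ord i < fold_ord j); have := rule (~~ (fold_ord i < fold_ord j)).
  by rewrite negbK; case: (i < m); case: (j < m).
rewrite sum_fold /wins; apply: eq_bigr => b _; rewrite !mxE.
have [ib | iNb] := eqVneq (fold_ord i) b.
  by rewrite ib x0 !t_fold ?fold_rev ?fold_unfold.
have x_le2 : x (fold_ord i) b <= 2 by rewrite -(xC _ _ iNb) leq_addr.
have flip : (b < fold_ord i) = ~~ (fold_ord i < b).
  exact: ltn_ord_neq.
rewrite /t /tie fold_rev fold_unfold sideC flip.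
have -> : unfold_ord b < m := ltn_ord b.
case: (i < m) => /=; first exact: round_half_sum.
by rewrite addnC; exact: round_half_sum.
Qed.

Lemma tnth_palindrome (r : m.-tuple nat) (R : n.-tuple nat) i :
  R = r ++ rev r :> seq nat -> tnth R i = tnth r (fold_ord i).
Proof.
move=> RE; rewrite !(tnth_nth 0) RE nth_cat size_tuple /=.
have i_n := ltn_ord i; case: (ltnP i m) => im.
  by congr (nth 0 r _); lia.
by rewrite nth_rev size_tuple; [congr (nth 0 r _)|]; lia.
Qed.

End Fold.

Theorem theorem23 (n : nat) (n_even : ~~ odd n)
    (r : (n./2).-tuple nat) (R : n.-tuple nat)
    (R_palindrome : R = r ++ rev r :> seq nat)
    (r_nondecreasing : sorted leq r) :
  (exists T : 'M[nat]_n,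
     comb_skew_hankel_tournament T /\ score_vector T = R) <->
  ((forall k : nat, 1 <= k <= n./2 ->
      k * (k - 1) <= \sum_(i < n./2 | i < k) tnth r i) /\
   \sum_(i < n./2) tnth r i = n./2 * (n./2 - 1)).
Proof.
have nE : n = (n./2).*2 by rewrite even_halfK.
have bin_double k : 2 * 'C(k, 2) = k * (k - 1).
  by rewrite -mul_bin_diag bin1 subn1.
have r_mono : {homo tnth r : i j / i <= j}.
  move=> i j ij; rewrite !(tnth_nth 0).
  by apply: (sorted_leq_nth leq_trans leqnn) => //; rewrite inE size_tuple.
have -> : (exists T : 'M[nat]_n,
    comb_skew_hankel_tournament T /\ score_vector T = R) <->
    exists2 x, match_results 2 x & wins x =1 tnth r.
  split=> [[T [TP TR]] | [x xP xr]].
    have [x xP xT] := match_results_of_tournament nE TP.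
    exists x => // a; rewrite xT -{2}[a](fold_unfold nE).
    by rewrite -(tnth_palindrome nE _ R_palindrome) -TR tnth_mktuple.
  have [T TP Tx] := tournament_of_match_results nE xP.
  exists T; split=> //; apply: eq_from_tnth => i.
  by rewrite tnth_mktuple Tx xr (tnth_palindrome nE i R_palindrome).
rewrite landau card_ord bin_double; split=> -[r_ge r_sum]; split=> //.
  move=> k /andP[_ km]; rewrite -bin_double.
  have := r_ge [set i : 'I_(n./2) | i < k]; under eq_bigl do rewrite inE.
  by rewrite card_ord_lt.
move=> A; apply: leq_trans (min_sum_ord A r_mono); rewrite bin_double.
case: (posnP #|A|) => [->|A_gt0] //; apply: r_ge; rewrite A_gt0.
by rewrite -[leqRHS]card_ord max_card.
Qed.
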